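(* Let $n,d$ be integers with $1\le d\le n-d$. The Specht ideal $I_{(n-d,d)}^{\mathrm{Sp}}\subset R$ is a radical ideal.
   Context: Let $K$ be a field, $[n]=\{1,\ldots,n\}$, and $R=K[x_1,\ldots,x_n]$. For a partition $\lambda=(\lambda_1\ge\cdots\ge\lambda_l\ge1)$ of $n$, a tableau of shape $\lambda$ is a bijection from $[n]$ to the set of boxes of the (left-justified) Young diagram of $\lambda$, which has $\lambda_i$ boxes in row $i$. For a tableau $T$ of shape $\lambda$, if the $j$-th column of $T$ consists of $j_1,\ldots,j_m$ from top to bottom, set $f_T(j)=\prod_{1\le s<t\le m}(x_{j_s}-x_{j_t})$ (equal to $1$ if $m=1$), and let the Specht polynomial of $T$ be $f_T=\prod_{j=1}^{\lambda_1}f_T(j)$. The Specht ideal is $I_\lambda^{\mathrm{Sp}}=(f_T\mid T\text{ a tableau of shape }\lambda)\subset R$. *)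

(* Defs.v *)
From HB Require Import structures.
From mathcomp Require Import all_boot all_order all_algebra.
From mathcomp Require Import mpoly.

Set Implicit Arguments.
Unset Strict Implicit.
Unset Printing Implicit Defensive.

Import GRing.Theory.
Local Open Scope ring_scope.

(* Ideals are Prop-valued predicates: the boolean [idealr] of [ring_quotient]
   requires properness and decidable membership. *)
Definition is_ideal (A : comNzRingType) (I : A -> Prop) : Prop :=
  [/\ I 0, (forall f g, I f -> I g -> I (f + g))
     & (forall a f, I f -> I (a * f))].

Definition radical (A : comNzRingType) (I : A -> Prop) : A -> Prop :=
  fun f => exists k : nat, I (f ^+ k).

Definition is_radical_ideal (A : comNzRingType) (I : A -> Prop) : Prop :=
  is_ideal I /\ (forall f, radical I f -> I f).

Definition ideal_gen (A : comNzRingType) (S : A -> Prop) : A -> Prop :=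
  fun f => exists s : seq (A * A),
    (forall p, p \in s -> S p.2) /\ f = \sum_(p <- s) p.1 * p.2.

Lemma ideal_gen_is_ideal (A : comNzRingType) (S : A -> Prop) :
  is_ideal (ideal_gen S).
Proof.
split.
- by exists [::]; rewrite big_nil.
- move=> _ _ [s [Ss ->]] [t [St ->]]; exists (s ++ t); rewrite big_cat /=.
  by split=> // p; rewrite mem_cat => /orP[/Ss | /St].
- move=> a _ [s [Ss ->]]; exists [seq (a * p.1, p.2) | p <- s]; split.
    by move=> _ /mapP[p /Ss Sp ->].
  by rewrite big_map mulr_sumr; apply: eq_bigr => p _; rewrite mulrA.
Qed.

Definition is_partition (n : nat) (la : seq nat) : bool :=
  [&& sorted geq la, all (leq 1) la & sumn la == n].

Lemma two_row_partition (n d : nat) (hd : (1 <= d)%N) (hdn : (d <= n - d)%N) :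
  is_partition n [:: n - d; d]%N.
Proof.
have hn : (d <= n)%N := leq_trans hdn (leq_subr d n).
by rewrite /is_partition /= addn0 subnK // eqxx hd (leq_trans hd hdn) !andbT.
Qed.

(* A box is a pair (row, column), both counted from 0; row i has columns
   0, ..., la_i - 1. *)
Definition box (la : seq nat) : finType :=
  {b : 'I_(size la) * 'I_(head 0%N la) | (b.2 < nth 0 la b.1)%N}.

Definition box_row (la : seq nat) (b : box la) : 'I_(size la) := (val b).1.
Definition box_col (la : seq nat) (b : box la) : 'I_(head 0%N la) := (val b).2.

(* 'I_n stands for [n], with entries shifted by one. *)
Record tableau (n : nat) (la : seq nat) := Tableau {
  tab_box :> 'I_n -> box la;
  tab_bij : bijective tab_box }.

(* The pairs (j_s, j_t) with s < t are the pairs (a, b) of entries of column j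
   such that a lies strictly above b. *)
Definition specht_col (K : fieldType) (n : nat) (la : seq nat)
    (T : tableau n la) (j : 'I_(head 0%N la)) : {mpoly K[n]} :=
  \prod_(a < n | box_col (T a) == j)
    \prod_(b < n | (box_col (T b) == j) && (box_row (T a) < box_row (T b))%N)
      ('X_a - 'X_b).

Definition specht_poly (K : fieldType) (n : nat) (la : seq nat)
    (T : tableau n la) : {mpoly K[n]} :=
  \prod_(j < head 0%N la) specht_col K T j.

Definition specht_ideal (K : fieldType) (n : nat) (la : seq nat) :
    {mpoly K[n]} -> Prop :=
  ideal_gen (fun f => exists T : tableau n la, f = specht_poly K T).

Arguments specht_ideal K n la _ : clear implicits.

(* Main.v *)
From HB Require Import structures.
Require Import Defs.
From mathcomp Require Import all_boot all_order all_algebra.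
From mathcomp Require Import mpoly.
From mathcomp Require Import zify ring.

(** Why the theorem is true.  A two-row Specht polynomial is a product of
    differences x_a - x_b over d pairwise disjoint pairs of indices, and every
    such product occurs.  By the pigeonhole principle it vanishes at each point
    that takes one value more than n - d times.  The set of all polynomials
    vanishing at these points, with coordinates in the domain K[x_1..x_n], is
    obviously radical, so everything rests on the converse: a polynomial that
    vanishes at all of them is in the Specht ideal.

    For the converse the statement is generalized from the set [n] to a multiset
    s of indices: the products run over d disjoint pairs taken from s, and the
    points are those at which more than |s| - d members of s, counted with
    multiplicity, take one value; variables outside s act as constants.  It is
    proved when 2 d <= |s| for the multisets in which one index z may be
    repeated and all others are simple, by induction on the number of simple
    indices.  Write s = m + s' with m simple and different from z.

    If 2 d < |s|, let f vanish at the points for (s, d).  Then f vanishes at the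
    points for (s', d - 1), because m may be counted against the loss of one
    pair.  By induction f is a combination of products g of d - 1 pairs from s'.
    Each g leaves some b in s' unpaired and (x_m - x_b) g is a product of d
    pairs, so modulo the ideal x_m can be replaced by x_b in the coefficient of
    g ([eliminate]).  What remains does not involve x_m, hence vanishes at the
    points for (s', d), and induction applies again ([spare_vertex_step]).

    If 2 d = |s|, this last appeal to induction is impossible since |s'| < 2 d.
    Instead m is merged with z: f with x_m := x_z vanishes at the points for the
    multiset in which m is replaced by a second copy of z, so by induction it is
    a combination of products there, and replacing one z by m in each product
    lifts it back to the ideal up to a multiple of x_m - x_z ([lift_merged]).
    This leaves (x_m - x_z) h.  After elimination of x_m from h, the result
    vanishes at the points for (s - m - z, d - 1), so it is a combination of
    products of d - 1 pairs avoiding m and z, to each of which x_m - x_z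
    contributes the missing pair ([perfect_step]).  Merging raises the
    multiplicity of z, which is why repeated indices have to be allowed. *)

Set Implicit Arguments.
Unset Strict Implicit.
Unset Printing Implicit Defensive.

Import GRing.Theory.
Local Open Scope ring_scope.

(** * Ideals *)

Section IdealFacts.
Variables (A : comNzRingType) (I : A -> Prop).
Hypothesis idI : is_ideal I.

Lemma ideal_sub f g : I f -> I g -> I (f - g).
Proof. by case: idI => _ ID IM If Ig; rewrite -mulN1r; apply/ID/IM. Qed.

Lemma ideal_gen_least (S : A -> Prop) :
  (forall g, S g -> I g) -> forall f, ideal_gen S f -> I f.
Proof.
case: idI => I0 ID IM SI _ [s [Ss ->]].
rewrite big_seq; elim/big_ind: _ => // p sp.
exact/IM/SI/Ss.
Qed.

End IdealFacts.

Lemma ideal_gen_incl (A : comNzRingType) (S : A -> Prop) g :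
  S g -> ideal_gen S g.
Proof.
move=> Sg; exists [:: (1, g)]; rewrite big_seq1 mul1r.
by split=> // p; rewrite inE => /eqP ->.
Qed.

(** * Points and substitutions *)

Section Evaluation.
Variables (K : fieldType) (n : nat).
Local Notation R := {mpoly K[n]}.

Lemma mpoly_rmorph_ext (S : comNzRingType) (phi psi : {rmorphism R -> S}) :
    (forall c, phi c%:MP = psi c%:MP) -> (forall i, phi 'X_i = psi 'X_i) ->
  phi =1 psi.
Proof.
move=> eqC eqX; elim/mpolyind => [|c e p _ _ IHp]; first by rewrite !rmorph0.
rewrite !rmorphD IHp -mul_mpolyC !rmorphM eqC; congr (_ * _ + _).
rewrite mpolyXE_id !rmorph_prod.
by apply: eq_bigr => i _; rewrite !rmorphXn eqX.
Qed.

(** Points have coordinates in the polynomial ring itself: it is an infinite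
    domain even when K is finite, and it contains the generic point. *)
Definition ev (v : 'I_n -> R) : R -> R := mmap (@mpolyC n K) v.
HB.instance Definition _ v := GRing.RMorphism.on (ev v).

Lemma ev_var v i : ev v 'X_i = v i.
Proof. by rewrite /ev mmapX mmap1U. Qed.

Lemma ev_const v c : ev v c%:MP = c%:MP.
Proof. by rewrite /ev mmapC. Qed.

Lemma eq_ev v w : v =1 w -> ev v =1 ev w.
Proof.
move=> vw; apply: mpoly_rmorph_ext => [c|i]; first by rewrite /= !ev_const.
by rewrite /= !ev_var.
Qed.

Lemma ev_id f : ev (fun i => 'X_i) f = f.
Proof.
apply: (@mpoly_rmorph_ext _ (ev (fun i => 'X_i)) idfun) => [c|i].
  by rewrite /= ev_const.
by rewrite /= ev_var.
Qed.

Definition upd (v : 'I_n -> R) (m : 'I_n) (a : R) : 'I_n -> R :=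
  fun i => if i == m then a else v i.

Definition subst (m b : 'I_n) : R -> R := ev (upd (fun i => 'X_i) m 'X_b).
HB.instance Definition _ m b := GRing.RMorphism.on (subst m b).

Lemma ev_subst v m b f : ev v (subst m b f) = ev (upd v m (v b)) f.
Proof.
apply: (@mpoly_rmorph_ext _ (ev v \o subst m b) (ev (upd v m (v b)))) => [c|i].
  by rewrite /= /subst !ev_const.
by rewrite /= /subst !ev_var /upd; case: eqP; rewrite ev_var.
Qed.

Lemma subst_congr m b f :
  exists q, f - subst m b f = ('X_m - 'X_b) * q.
Proof.
elim/mpolyind: f => [|c e p _ _ [q Dq]].
  by exists 0; rewrite rmorph0 subrr mulr0.
have [q1 Dq1]: exists q, 'X_[e] - subst m b 'X_[e] = ('X_m - 'X_b) * q.
  rewrite mpolyXE_id rmorph_prod.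
  elim/big_ind2: _ => [|x1 x2 y1 y2 [q1 D1] [q2 D2]|i _].
  - by exists 0; rewrite subrr mulr0.
  - exists (q1 * y1 + x2 * q2).
    by rewrite mulrDr mulrA -D1 (mulrCA _ x2) -D2; ring.
  rewrite rmorphXn /= subrXX /subst ev_var /upd.
  case: eqP => [-> |_]; first by eexists.
  by exists 0; rewrite subrr mul0r mulr0.
exists (c%:MP * q1 + q).
rewrite -mul_mpolyC rmorphD rmorphM /= {1}/subst ev_const.
by rewrite mulrDr (mulrCA _ c%:MP) -Dq1 -Dq; ring.
Qed.

(** As a function of the coordinate m, the value of f is a univariate polynomial
    over an infinite domain, so one exceptional coordinate does not matter. *)
Lemma ev_density v m a f :
  (forall t, t != a -> ev (upd v m t) f = 0) -> forall t, ev (upd v m t) f = 0.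
Proof.
move=> f0.
(* p is f with all coordinates but m specialized. *)
pose w i : {poly R} := if i == m then 'X else (v i)%:P.
pose p : {poly R} := mmap (polyC \o @mpolyC n K) w f.
have pE t : p.[t] = ev (upd v m t) f.
  pose phi := horner_eval t \o mmap (polyC \o @mpolyC n K) w.
  apply: (@mpoly_rmorph_ext _ phi (ev (upd v m t))) => [c|i].
    by rewrite /phi /= mmapC /= ev_const /horner_eval hornerC.
  rewrite /phi /= mmapX mmap1U ev_var /upd /w /horner_eval.
  by case: eqP; rewrite ?hornerX ?hornerC.
suff p0 : p = 0 by move=> t; rewrite -pE p0 horner0.
suff: p * ('X - a%:P) = 0.
  by move/eqP; rewrite mulf_eq0 polyXsubC_eq0 orbF => /eqP.
(* The powers of x_m are as many distinct values as needed. *)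
pose rs := [seq ('X_m : R) ^+ i | i <- iota 0 (size (p * ('X - a%:P)))].
apply: (@roots_geq_poly_eq0 _ _ rs); last by rewrite size_map size_iota.
  apply/allP => t _; rewrite rootM root_XsubC rootE pE.
  by case: (eqVneq t a) => [|/f0 ->]; rewrite ?orbT ?eqxx.
rewrite map_inj_uniq ?iota_uniq // => i j /(congr1 (fun p : R => msize p)).
by rewrite !mpolyXn !msizeX !mdegMn mdeg1 !mul1n => -[].
Qed.

(** Independence of x_m, in the form in which it is used: values at points do
    not depend on the coordinate m. *)
Definition free_of (m : 'I_n) (f : R) : Prop :=
  forall v t, ev (upd v m t) f = ev v f.

End Evaluation.

(** * Products over disjoint pairs and their zeros *)

Section Pairings.
Variables (K : fieldType) (n : nat).
Local Notation R := {mpoly K[n]}.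
Implicit Types (s r : seq 'I_n) (t : seq ('I_n * 'I_n)) (f g : R).

Definition pair_prod t : R := \prod_(p <- t) ('X_p.1 - 'X_p.2).

Definition entries t : seq 'I_n := flatten [seq [:: p.1; p.2] | p <- t].

(** The list r collects the members of s left unpaired.  As s may repeat an
    index, a pair may be (z, z), and then the product is zero. *)
Definition pairing_ideal s d : R -> Prop :=
  ideal_gen (fun g => exists t r,
    [/\ size t = d, perm_eq (entries t ++ r) s & g = pair_prod t]).

Definition mult (v : 'I_n -> R) (c : R) s : nat := count (fun i => v i == c) s.
Arguments mult : simpl never.

(** The value c is taken on more than size s - d members of s, stated without
    subtraction. *)
Definition vanishing s d f : Prop :=
  forall v c, (size s < mult v c s + d)%N -> ev v f = 0.

Lemma mult_cons v c i s : mult v c (i :: s) = ((v i == c) + mult v c s)%N.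
Proof. by []. Qed.

Lemma pairing_is_ideal s d : is_ideal (pairing_ideal s d).
Proof. exact: ideal_gen_is_ideal. Qed.

Lemma pairing_gen s d t r :
  size t = d -> perm_eq (entries t ++ r) s -> pairing_ideal s d (pair_prod t).
Proof. by move=> sz p; apply: ideal_gen_incl; exists t, r. Qed.

Lemma perm_pairing s1 s2 d f :
  perm_eq s1 s2 -> pairing_ideal s1 d f -> pairing_ideal s2 d f.
Proof.
move=> s12; apply: ideal_gen_least; first exact: pairing_is_ideal.
by move=> _ [t [r [sz p ->]]]; apply: pairing_gen sz (perm_trans p s12).
Qed.

Lemma perm_vanishing s1 s2 d f :
  perm_eq s1 s2 -> vanishing s1 d f -> vanishing s2 d f.
Proof.
move=> s12 vf v c; rewrite /mult -(perm_size s12) -(permP s12); exact: vf.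
Qed.

Lemma vanishing_is_ideal s d : is_ideal (vanishing s d).
Proof.
split=> [v c _|f g vf vg v c h|a f vf v c h]; first by rewrite rmorph0.
  by rewrite rmorphD /= (vf _ _ h) (vg _ _ h) addr0.
by rewrite rmorphM /= (vf _ _ h) mulr0.
Qed.

Lemma size_entries t : size (entries t) = (2 * size t)%N.
Proof. by elim: t => //= p t; rewrite /entries /= => ->; lia. Qed.

Lemma ev_pair_prod v t :
  ev v (pair_prod t) = \prod_(p <- t) (v p.1 - v p.2).
Proof.
by rewrite rmorph_prod; apply: eq_bigr => p _; rewrite rmorphB /= !ev_var.
Qed.

(** If no pair had equal coordinates, each of the d pairs would have at most
    one member at which the value c is taken, so at least d members of s would
    not take it. *)
Lemma pairing_vanishing s d f : pairing_ideal s d f -> vanishing s d f.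
Proof.
apply: ideal_gen_least; first exact: vanishing_is_ideal.
move=> _ [t [r [<- /[dup] /permP cnt /perm_size sz ->]]] v c.
rewrite /mult -sz -cnt count_cat size_cat size_entries => big.
apply/eqP; rewrite ev_pair_prod prodf_seq_eq0; apply/hasP.
have [|/hasPn neq] := boolP (has (fun p => v p.1 - v p.2 == 0) t).
  by move=> /hasP[p tp vp]; exists p.
suff le_t : (mult v c (entries t) <= size t)%N.
  move: big; rewrite ltnNge => /negP[].
  by rewrite addnAC mul2n -addnn leq_add ?leq_add2r ?count_size.
elim: t neq {big cnt sz} => //= p t IHt neq.
have /IHt IH: forall x, x \in t -> v x.1 - v x.2 != 0.
  by move=> x tx; apply: neq; rewrite inE tx orbT.
have := neq p (mem_head _ _); rewrite subr_eq0 => neqp.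
suff: ((v p.1 == c) + (v p.2 == c) <= 1)%N.
  by move: IH; rewrite /entries /= !mult_cons; lia.
by case: (v p.1 =P c) neqp => [->|_]; case: (v p.2 =P c) => // ->; rewrite eqxx.
Qed.

Lemma perm_entries t1 t2 : perm_eq t1 t2 -> perm_eq (entries t1) (entries t2).
Proof. by move=> t12; apply/perm_flatten/perm_map. Qed.

Lemma perm_entries_unzip t : perm_eq (entries t) (unzip1 t ++ unzip2 t).
Proof.
elim: t => //= p t IHt; rewrite perm_cons -(cat1s p.2 (unzip2 t)) perm_sym.
by rewrite perm_catCA /= perm_cons perm_sym.
Qed.

Lemma pairing0 s f : pairing_ideal s 0 f.
Proof.
have [_ _ IM] := pairing_is_ideal s 0; rewrite -[f]mulr1; apply: IM.
rewrite -[1](_ : pair_prod [::] = 1); last by rewrite /pair_prod big_nil.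
exact: (@pairing_gen _ _ _ s).
Qed.

Lemma pairing_consl m s d f : pairing_ideal s d f -> pairing_ideal (m :: s) d f.
Proof.
apply: ideal_gen_least; first exact: pairing_is_ideal.
move=> _ [t [r [sz p ->]]]; apply: (@pairing_gen _ _ _ (m :: r)) => //.
by rewrite -cat1s perm_catCA /= perm_cons.
Qed.

Lemma pairing_mul_edge a b s d f :
  pairing_ideal s d f -> pairing_ideal [:: a, b & s] d.+1 (('X_a - 'X_b) * f).
Proof.
have [I0 ID IM] := pairing_is_ideal [:: a, b & s] d.+1.
apply: (@ideal_gen_least _ (fun f => pairing_ideal _ _ (_ * f))).
  split=> [|g h Ig Ih|g h Ih]; first by rewrite mulr0.
    by rewrite mulrDr; apply: ID.
  by rewrite mulrCA; apply: IM.
move=> _ [t [r [sz p ->]]].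
have -> : ('X_a - 'X_b) * pair_prod t = pair_prod ((a, b) :: t).
  by rewrite /pair_prod big_cons.
by apply: (@pairing_gen _ _ _ r); rewrite /= ?sz // !perm_cons.
Qed.

(** The index m may or may not take the common value, but its presence in s
    makes up for the additional pair. *)
Lemma vanishing_tail m s d f : vanishing (m :: s) d.+1 f -> vanishing s d f.
Proof. by move=> vf v c h; apply: (vf v c); rewrite mult_cons /=; lia. Qed.

Lemma mult_upd v m (a c : R) s : m \notin s ->
  mult (upd v m a) c s = mult v c s.
Proof.
move=> ms; apply: eq_in_count => i si; rewrite /upd.
by case: (i =P m) si ms => // -> ->.
Qed.

(** The coordinate m can be moved to the common value without changing the
    value of f, and this adds one to the multiplicity. *)
Lemma vanishing_free m s d f : m \notin s -> free_of m f ->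
  vanishing (m :: s) d f -> vanishing s d f.
Proof.
move=> ms free vf v c h; rewrite -(free v c); apply: (vf _ c).
by rewrite /= !mult_cons mult_upd // /upd !eqxx; lia.
Qed.

Lemma free_ofD m f g : free_of m f -> free_of m g -> free_of m (f + g).
Proof. by move=> Ff Fg v a; rewrite !rmorphD /= Ff Fg. Qed.

Lemma free_ofM m f g : free_of m f -> free_of m g -> free_of m (f * g).
Proof. by move=> Ff Fg v a; rewrite !rmorphM /= Ff Fg. Qed.

Lemma free_of_subst m b f : b != m -> free_of m (subst m b f).
Proof.
move=> bm v a; rewrite !ev_subst; apply: eq_ev => i.
by rewrite /upd (negPf bm); case: eqP.
Qed.

Lemma free_of_pair_prod m t : m \notin entries t -> free_of m (pair_prod t).
Proof.
elim: t => [|p t IHt] mt v a; first by rewrite /pair_prod big_nil !rmorph1.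
move: mt; rewrite /entries /= !inE !negb_or => /and3P[m1 m2 mt].
rewrite /pair_prod big_cons; apply: free_ofM; last exact: IHt.
move=> w c; rewrite !rmorphB /= !ev_var /upd.
by rewrite ![_ == m]eq_sym (negPf m1) (negPf m2).
Qed.

(** * Eliminating a variable *)

(** A product of d pairs from s leaves an index b of s unpaired, and modulo the
    products of d + 1 pairs from m :: s its coefficients may be taken at
    x_m := x_b. *)
Lemma eliminate m s d f : m \notin s -> (2 * d < size s)%N ->
    pairing_ideal s d f ->
  exists2 f', free_of m f' & pairing_ideal (m :: s) d.+1 (f - f').
Proof.
move=> ms lt_ds.
have [I0 ID IM] := pairing_is_ideal (m :: s) d.+1.
case=> l [Sl ->]; elim: l Sl => [|[h g] l IHl] Sl.
  exists 0; first by move=> v a; rewrite !rmorph0.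
  by rewrite big_nil subr0.
have [|f' Ff' If'] := IHl; first by move=> x lx; apply: Sl; rewrite inE lx orbT.
have [t [r [sz p /= ->]]] := Sl (h, g) (mem_head _ _).
have [b [r' Dr]] : exists b r', r = b :: r'.
  case: r p => [|b r' _]; last by exists b, r'.
  rewrite cats0 => /perm_size; rewrite size_entries sz => Ds.
  by rewrite -Ds ltnn in lt_ds.
have sub x : x \in entries t ++ r -> x != m.
  by rewrite (perm_mem p); apply: contraTneq => ->.
exists (subst m b h * pair_prod t + f').
  apply: free_ofD => //; apply: free_ofM.
    by apply/free_of_subst/sub; rewrite Dr mem_cat mem_head orbT.
  apply: free_of_pair_prod; apply/negP => mt.
  by have := sub m; rewrite mem_cat mt eqxx => /(_ isT).
rewrite big_cons /= opprD addrACA -mulrBl; apply: ID => //.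
have [q ->] := subst_congr m b h; rewrite mulrAC mulrC; apply: IM.
have -> : ('X_m - 'X_b) * pair_prod t = pair_prod ((m, b) :: t).
  by rewrite /pair_prod big_cons.
apply: (@pairing_gen _ _ _ r'); rewrite /= ?sz // perm_cons.
by rewrite -(permPr p) Dr -(cat1s b (_ ++ _)) perm_catCA.
Qed.

(** Undoing the identification of m with z: exchanging one z for m in a product
    that uses this copy of z changes it by a multiple of x_m - x_z. *)
Lemma lift_merged m z s d f : pairing_ideal [:: z, z & s] d f ->
  exists q, pairing_ideal [:: m, z & s] d (f - ('X_m - 'X_z) * q).
Proof.
set s2 := [:: m, z & s].
have [I0 ID IM] := pairing_is_ideal s2 d.
apply: (@ideal_gen_least _
  (fun f => exists q, pairing_ideal s2 d (f - ('X_m - 'X_z) * q))).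
  split=> [|g h [q1 I1] [q2 I2]|g h [q Iq]].
  - by exists 0; rewrite mulr0 subr0.
  - by exists (q1 + q2); rewrite mulrDr opprD addrACA; apply: ID.
  - by exists (g * q); rewrite mulrCA -mulrBr; apply: IM.
move=> _ [t [r [sz p ->]]].
have: z \in entries t ++ r by rewrite (perm_mem p) mem_head.
rewrite mem_cat => /orP[/flatten_mapP[[a b] tab] | rz]; last first.
  exists 0; rewrite mulr0 subr0.
  apply: (@pairing_gen _ _ _ (m :: rem z r)) => //.
  rewrite -cat1s perm_catCA /= perm_cons -(perm_cons z) -(permPr p).
  by rewrite -cat1s perm_catCA perm_cat2l perm_sym perm_to_rem.
pose t' := rem (a, b) t.
have tt' : perm_eq t ((a, b) :: t') by exact: perm_to_rem.
have pt : pair_prod t = ('X_a - 'X_b) * pair_prod t'.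
  by rewrite /pair_prod (perm_big _ tt') big_cons.
have szt : size t = (size t').+1 by rewrite (perm_size tt').
have p' : perm_eq ([:: a; b] ++ entries t' ++ r) [:: z, z & s].
  by rewrite -(permPr p) catA perm_cat2r perm_sym (perm_entries tt').
rewrite !inE => /orP[] /eqP Dz /=.
- exists (- pair_prod t'); rewrite pt mulrN opprK -mulrDl.
  have -> : 'X_a - 'X_b + ('X_m - 'X_z) = 'X_m - 'X_b :> R by rewrite Dz; ring.
  have -> : ('X_m - 'X_b) * pair_prod t' = pair_prod ((m, b) :: t').
    by rewrite /pair_prod big_cons.
  apply: (@pairing_gen _ _ _ r); first by rewrite /= -szt.
  by rewrite /= perm_cons -(perm_cons z) {1}Dz.
- exists (pair_prod t'); rewrite pt -mulrBl.
  have -> : 'X_a - 'X_b - ('X_m - 'X_z) = 'X_a - 'X_m :> R by rewrite Dz; ring.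
  have -> : ('X_a - 'X_m) * pair_prod t' = pair_prod ((a, m) :: t').
    by rewrite /pair_prod big_cons.
  apply: (@pairing_gen _ _ _ r); first by rewrite /= -szt.
  rewrite /= -(cat1s a) -(cat1s m) perm_catCA /= perm_cons -(perm_cons z) {1}Dz.
  by apply: perm_trans p'; apply/permPl/(perm_catCA [:: b] [:: a]).
Qed.

(** * The induction *)

Definition vanishing_sub_pairing s d : Prop :=
  forall f, vanishing s d f -> pairing_ideal s d f.

(** The case used when d + 1 disjoint pairs cannot exhaust m :: s: once x_m is
    eliminated, the remainder is covered by the statement for s alone. *)
Lemma spare_vertex_step m s d : m \notin s -> (2 * d < size s)%N ->
    vanishing_sub_pairing s d -> vanishing_sub_pairing s d.+1 ->
  vanishing_sub_pairing (m :: s) d.+1.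
Proof.
move=> ms lt_ds IH1 IH2 f vf.
have [f' Ff' Iff'] := eliminate ms lt_ds (IH1 _ (vanishing_tail vf)).
have [_ ID _] := pairing_is_ideal (m :: s) d.+1.
rewrite -[f](subrK f'); apply: ID => //; apply/pairing_consl/IH2.
apply: (vanishing_free ms Ff').
have -> : f' = f - (f - f') by ring.
by apply: (ideal_sub (vanishing_is_ideal _ _)); last exact: pairing_vanishing.
Qed.

(** The case used when d + 1 disjoint pairs exhaust [:: m, z & s].  The part of
    f that survives setting x_m := x_z is handled by merging m with z; the rest
    is (x_m - x_z) h, and the factor x_m - x_z is the pair (m, z) itself. *)
Lemma perfect_step m z s d : m \notin z :: s -> (2 * d <= size s)%N ->
    vanishing_sub_pairing [:: z, z & s] d.+1 -> vanishing_sub_pairing (z :: s) d ->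
    vanishing_sub_pairing s d ->
  vanishing_sub_pairing [:: m, z & s] d.+1.
Proof.
move=> mzs le_ds IHm IHt IHe f vf.
have /norP[mz ms] : ~~ ((m == z) || (m \in s)) by rewrite -in_cons.
have [I0 ID IM] := pairing_is_ideal [:: m, z & s] d.+1.
have vI := vanishing_is_ideal.
have /IHm/(lift_merged m)[q1 Iq1] : vanishing [:: z, z & s] d.+1 (subst m z f).
  move=> v c h; rewrite ev_subst; apply: (vf _ c).
  rewrite /= !mult_cons mult_upd // /upd eqxx [z == m]eq_sym (negPf mz).
  exact: h.
have [q2 Dq2] := subst_congr m z f.
pose e := ('X_m - 'X_z : R).
pose h := q1 + q2.
have Df : f = (subst m z f - e * q1) + e * h.
  by rewrite /h mulrDr -Dq2; ring.
rewrite Df; apply: (ID) => //.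
have veh : vanishing [:: m, z & s] d.+1 (e * h).
  have -> : e * h = f - (subst m z f - e * q1) by rewrite {1}Df; ring.
  by apply: (ideal_sub (vI _ _)) => //; apply: pairing_vanishing.
(* Off the hyperplane x_m = x_z, the factor e can be cancelled. *)
have ev_h v c : v m != v z ->
    (size [:: m, z & s] < mult v c [:: m, z & s] + d.+1)%N ->
  ev v h = 0.
  move=> vmz /veh; rewrite rmorphM rmorphB /= !ev_var => /eqP.
  by rewrite mulf_eq0 subr_eq0 (negPf vmz) => /eqP.
(* The coordinate m is free here, so the hyperplane can be avoided. *)
have vh : vanishing (z :: s) d h.
  move=> v c lt_c.
  rewrite -(@eq_ev _ _ (upd v m (v m))) => [|i]; last first.
    by rewrite /upd; case: eqP => // ->.
  apply: (@ev_density _ _ _ _ (v z)) => a avz; apply: (ev_h _ c).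
    by rewrite /upd eqxx [z == m]eq_sym (negPf mz).
  move: lt_c; rewrite /= !mult_cons mult_upd // /upd eqxx [z == m]eq_sym.
  by rewrite (negPf mz); lia.
have [|h' Fh' Ihh'] := eliminate mzs _ (IHt _ vh); first by rewrite /=; lia.
have -> : e * h = e * (h - h') + e * h' by ring.
apply: ID; first exact: IM.
apply: pairing_mul_edge; apply: IHe => v c lt_c.
have Dh' : h' = h - (h - h') by ring.
(* If z takes the value c, it adds to the multiplicity; otherwise m is moved to
   c, which also keeps the point off the hyperplane. *)
have [vzc|vzc] := eqVneq (v z) c.
  have vh' : vanishing (z :: s) d h'.
    rewrite Dh'; apply: (ideal_sub (vI _ _)) => //.
    exact/vanishing_tail/pairing_vanishing/Ihh'.
  apply: (vh' _ c); rewrite mult_cons /= vzc eqxx; lia.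
rewrite -(Fh' v c).
have lt_c' : (size [:: m, z & s]
    < mult (upd v m c) c [:: m, z & s] + d.+1)%N.
  by rewrite /= !mult_cons mult_upd // /upd !eqxx; lia.
rewrite Dh' rmorphB /= (pairing_vanishing Ihh' lt_c') subr0.
by apply: ev_h lt_c'; rewrite /upd eqxx [z == m]eq_sym (negPf mz) eq_sym.
Qed.

(** The multiplicity w of z is arbitrary because merging increases it and
    splitting off a pair (m, z) decreases it; when it drops to zero, the next
    simple index takes the place of z. *)
Lemma vanishing_in_pairing V : uniq V ->
  forall w z d, z \notin V -> (2 * d <= w + size V)%N ->
  vanishing_sub_pairing (nseq w z ++ V) d.
Proof.
elim: V => [|m V IHV] /= uV w z [|d] zV le_d f vf; do ?exact: pairing0.
  (* Without simple indices every point qualifies, in particular the generic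
     one, so f = 0. *)
  rewrite -(ev_id f) (vf (fun i => 'X_i) 'X_z).
    by have [] := pairing_is_ideal (nseq w z ++ [::]) d.+1.
  by rewrite cats0 /mult count_nseq size_nseq eqxx; lia.
case/andP: uV => mV uV; move/norP: zV => [zm zV].
case: w le_d vf => [|w] le_d vf.
  by apply: (IHV uV 1%N m d.+1).
have IH w' d' le := IHV uV w' z d' zV le.
have mzs : m \notin z :: nseq w z ++ V.
  by rewrite !inE mem_cat mem_nseq [m == z]eq_sym (negPf zm) (negPf mV) andbF.
have pm : perm_eq (m :: nseq w.+1 z ++ V) (nseq w.+1 z ++ m :: V).
  by rewrite -(cat1s m (nseq _ _ ++ _)) perm_catCA.
apply: (perm_pairing pm).
have {vf}: vanishing (m :: nseq w.+1 z ++ V) d.+1 f.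
  by apply: perm_vanishing vf; rewrite perm_sym.
have [lt_d|ge_d] := ltnP (2 * d.+1) (w.+1 + (size V).+1).
  have le_d1 : (2 * d.+1 <= w.+1 + size V)%N by lia.
  have le_d0 : (2 * d <= w.+1 + size V)%N by lia.
  apply: (spare_vertex_step mzs _ (IH w.+1 d le_d0) (IH w.+1 d.+1 le_d1)) => //.
  by rewrite /= size_cat size_nseq; lia.
have le_2 : (2 * d.+1 <= w.+2 + size V)%N by rewrite addSnnS.
have le_1 : (2 * d <= w.+1 + size V)%N by lia.
have le_0 : (2 * d <= w + size V)%N by lia.
apply: (perfect_step mzs _ (IH _ _ le_2) (IH _ _ le_1) (IH _ _ le_0)) => //.
by rewrite size_cat size_nseq; lia.
Qed.

End Pairings.

(** * Two-row Specht polynomials *)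

Section TwoRowSpecht.
Variables (K : fieldType) (n d : nat).
Hypothesis hdn : (d <= n - d)%N.
Local Notation la := [:: (n - d)%N; d].

Definition top_box (j : 'I_d) : box la :=
  exist _ (ord0, widen_ord hdn j) (leq_trans (ltn_ord j) hdn).

Definition bot_box (j : 'I_d) : box la :=
  exist _ (ord_max, widen_ord hdn j) (ltn_ord j).

Lemma box_ext (b c : box la) :
  box_row b = box_row c :> nat -> box_col b = box_col c :> nat -> b = c.
Proof.
case: b c => [[i j] h] [[i' j'] h'] /= Dr Dc; apply: val_inj => /=.
by congr (_, _); apply: val_inj.
Qed.

Lemma above_in_column (b c : box la) :
  (box_col c == box_col b) && (box_row b < box_row c)%N <->
  exists j, b = top_box j /\ c = bot_box j.
Proof.
split=> [/andP[/eqP Dc lt_bc] | [j [-> ->]]]; last by rewrite eqxx.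
have lt2 : (box_row c < 2)%N := ltn_ord (box_row c).
have r1 : (box_row c : nat) = 1%N by lia.
have r0 : (box_row b : nat) = 0%N by lia.
have lt_d : (box_col c < d)%N.
  by have : (box_col c < nth 0 la (box_row c))%N := valP c; rewrite r1.
by exists (Ordinal lt_d); split; apply: box_ext => //=; rewrite -Dc.
Qed.

Section Tableau.
Variables (T : tableau n la) (g : box la -> 'I_n).
Hypotheses (TK : cancel T g) (gK : cancel g T).

Definition column_pairs :=
  [seq (g (top_box j), g (bot_box j)) | j <- enum 'I_d].

Lemma mem_column_pairs a b :
  ((a, b) \in column_pairs) =
  (box_col (T b) == box_col (T a)) && (box_row (T a) < box_row (T b))%N.
Proof.
apply/idP/idP => [/mapP[j _ [-> ->]]|/above_in_column[j [Da Db]]].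
  by rewrite !gK; apply/above_in_column; exists j.
by rewrite -(TK a) -(TK b) Da Db; apply: map_f; rewrite mem_enum.
Qed.

Lemma inv_tableau_inj : injective g. Proof. exact: can_inj gK. Qed.

Lemma uniq_column_pairs : uniq column_pairs.
Proof.
rewrite map_inj_uniq ?enum_uniq // => i j [/inv_tableau_inj Dij _].
by apply: val_inj; have /(congr1 (fun b => box_col b : nat)) := Dij.
Qed.

(** Only columns of height two contribute, with one factor each. *)
Lemma specht_poly_columns : specht_poly K T = pair_prod K column_pairs.
Proof.
rewrite /pair_prod big_uniq ?uniq_column_pairs //=.
rewrite (eq_bigl (fun p => (box_col (T p.2) == box_col (T p.1))
    && (box_row (T p.1) < box_row (T p.2))%N)); last first.
  by case=> a b; rewrite mem_column_pairs.
rewrite -(pair_big_dep xpredT (fun a b => (box_col (T b) == box_col (T a))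
    && (box_row (T a) < box_row (T b))%N) (fun a b => 'X_a - 'X_b)) /=.
rewrite (partition_big (fun a => box_col (T a)) xpredT) //=.
by apply: eq_bigr => j _; apply: eq_bigr => a /eqP ->.
Qed.

Lemma uniq_entries_column_pairs : uniq (entries column_pairs).
Proof.
rewrite (perm_uniq (perm_entries_unzip _)) /column_pairs.
move: (enum _) (enum_uniq 'I_d) => e ue.
rewrite /unzip1 /unzip2 -!map_comp cat_uniq.
have inj_box (f : 'I_d -> box la) :
    (forall j, box_col (f j) = j :> nat) -> injective (g \o f).
  by move=> fE i j /= /inv_tableau_inj E; apply: val_inj; rewrite /= -!fE E.
rewrite !map_inj_uniq ?ue; try exact: inj_box.
rewrite andbT; apply/hasPn => _ /mapP[j _ ->]; apply/mapP => -[i _ /=].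
by move=> /inv_tableau_inj /(congr1 (fun b => box_row b : nat)).
Qed.

End Tableau.

Lemma specht_in_pairing f :
  specht_ideal K n la f -> pairing_ideal (enum 'I_n) d f.
Proof.
apply: ideal_gen_least; first exact: pairing_is_ideal.
move=> _ [T ->]; have [g TK gK] := tab_bij T.
rewrite (specht_poly_columns TK gK); set t := column_pairs g.
have ut : uniq (entries t) := uniq_entries_column_pairs gK.
apply: (@pairing_gen _ _ _ _ _ [seq i <- enum 'I_n | i \notin entries t]).
  by rewrite size_map size_enum_ord.
apply: uniq_perm; [|exact: enum_uniq|].
  rewrite cat_uniq ut filter_uniq ?enum_uniq // andbT.
  by apply/hasPn => i; rewrite mem_filter => /andP[].
by move=> i; rewrite mem_cat mem_filter mem_enum andbT orbN.
Qed.

(** The top row consists of the first members of the pairs followed by the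
    unpaired indices, the bottom row of the second members. *)
Lemma tableau_of_pairs (t : seq ('I_n * 'I_n)) (r : seq 'I_n) :
    (0 < n)%N -> size t = d -> perm_eq (entries t ++ r) (enum 'I_n) ->
  exists T : tableau n la, specht_poly K T = pair_prod K t.
Proof.
move=> n0 szt pt.
pose i0 : 'I_n := Ordinal n0.
pose rows := (unzip1 t ++ r) ++ unzip2 t.
have pr : perm_eq rows (enum 'I_n).
  rewrite -(permPr pt) /rows -catA perm_sym.
  rewrite (permPl (perm_cat (perm_entries_unzip t) (perm_refl r))).
  by rewrite -catA perm_cat2l perm_catC.
have urows : uniq rows by rewrite (perm_uniq pr) enum_uniq.
have szr : size rows = n by rewrite (perm_size pr) size_enum_ord.
have sz0 : size (unzip1 t ++ r) = (n - d)%N.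
  have : size rows = (size (unzip1 t ++ r) + d)%N.
    by rewrite /rows (size_cat (_ ++ _)) [size (unzip2 t)]size_map szt.
  by rewrite szr; lia.
have dn : (d <= n)%N by lia.
(* The position of a box when the rows are read one after the other. *)
pose lin (b : box la) : nat := (box_row b * (n - d) + box_col b)%N.
have colP (b : box la) : (box_col b < nth 0 la (box_row b))%N := valP b.
have row2 (b : box la) : (box_row b = 0 :> nat) \/ (box_row b = 1 :> nat).
  by have : (box_row b < 2)%N := ltn_ord (box_row b); lia.
have lin_lt b : (lin b < n)%N.
  by rewrite /lin; have := colP b; case: (row2 b) => -> /=; lia.
have lin_inj : injective lin.
  move=> b c; rewrite /lin => Dbc.
  have lt_b : (box_col b < n - d)%N := ltn_ord (box_col b).
  have lt_c : (box_col c < n - d)%N := ltn_ord (box_col c).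
  by case: (row2 b) (row2 c) Dbc => Db [] Dc; rewrite Db Dc => Dbc;
    apply: box_ext; lia.
have lin_onto k : (k < n)%N -> exists b, lin b = k.
  move=> lt_k; have [h|h] := ltnP k (n - d).
    by exists (exist _ (ord0, Ordinal (h : (k < head 0 la)%N)) h).
  have h1 : (k - (n - d) < d)%N by lia.
  have h2 : (k - (n - d) < head 0 la)%N by exact: leq_trans h1 hdn.
  by exists (exist _ (ord_max, Ordinal h2) h1); rewrite /lin /=; lia.
pose g b := nth i0 rows (lin b).
have g_onto a : exists b, g b == a.
  have ar : a \in rows by rewrite (perm_mem pr) mem_enum.
  have [|b Db] := lin_onto (index a rows).
    by rewrite -[X in (_ < X)%N]szr index_mem.
  by exists b; rewrite /g Db nth_index.
have g_inj : injective g.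
  move=> b c /eqP; rewrite nth_uniq ?szr ?lin_lt // => /eqP; exact: lin_inj.
pose T0 a : box la := xchoose (g_onto a).
have TK : cancel T0 g by move=> a; apply/eqP; exact: (xchooseP (g_onto a)).
have gK : cancel g T0 by move=> b; apply: g_inj; rewrite TK.
exists (@Tableau n la T0 (Bijective TK gK)).
rewrite (@specht_poly_columns (Tableau (Bijective TK gK)) g) //; congr pair_prod.
apply: (@eq_from_nth _ (i0, i0)); first by rewrite size_map size_enum_ord szt.
move=> k; rewrite size_map size_enum_ord => lt_k.
rewrite (nth_map (Ordinal lt_k)) ?size_enum_ord // /g /lin /=.
rewrite nth_enum_ord // mul0n mul1n add0n /rows !nth_cat size_cat !size_map szt.
rewrite -sz0 size_cat size_map szt.
have -> : (k < d + size r)%N by lia.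
have -> : (d + size r + k < d + size r)%N = false by lia.
rewrite lt_k addKn !(nth_map (i0, i0)) ?szt //.
by case: (nth _ t k).
Qed.

Lemma pairing_in_specht f : (0 < n)%N ->
  pairing_ideal (enum 'I_n) d f -> specht_ideal K n la f.
Proof.
move=> n0; apply: ideal_gen_least; first exact: ideal_gen_is_ideal.
move=> _ [t [r [szt pt ->]]]; have [T <-] := tableau_of_pairs n0 szt pt.
by apply: ideal_gen_incl; exists T.
Qed.

End TwoRowSpecht.

Theorem theorem3p1 (K : fieldType) (n d : nat)
    (hd : (1 <= d)%N) (hdn : (d <= n - d)%N) :
  is_radical_ideal (specht_ideal K n [:: (n - d)%N; d]).
Proof.
split; first exact: ideal_gen_is_ideal.
move=> f [k fk]; have n0 : (0 < n)%N by lia.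
apply: (pairing_in_specht hdn n0).
have vf : vanishing (enum 'I_n) d f.
  move=> v c h; have := pairing_vanishing (specht_in_pairing hdn fk) h.
  by move/eqP; rewrite rmorphXn expf_eq0 => /andP[_ /eqP].
have sz := size_enum_ord n; have uV := enum_uniq 'I_n.
case: (enum 'I_n) sz uV vf => [|z V] /= sz; first by lia.
case/andP=> zV uV vf; apply: (@vanishing_in_pairing _ _ V uV 1%N z d zV) vf.
by rewrite add1n sz; lia.
Qed.
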